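(* Let $X$ be a Peano continuum and let $A = H_1(X)/\mathrm{tor}(H_1(X))$. Let $\mathrm{Div}(A)$ be the maximal divisible subgroup of $A$ and $\mathrm{red}(A)\cong A/\mathrm{Div}(A)$ the reduced part of $A$ (so $A = \mathrm{Div}(A)\oplus \mathrm{red}(A)$ for a reduced subgroup $\mathrm{red}(A)$, unique up to isomorphism). Then $\mathrm{red}(A)$ is either a free abelian group of finite rank or has cardinality $2^{\aleph_0}$.
   Context: A Peano continuum is a path connected, locally path connected, compact metrizable space. $\mathrm{tor}(H_1(X))$ is the torsion subgroup of $H_1(X)$. An abelian group is divisible if every element has an $n$-th root for every positive integer $n$, and reduced if it has no nontrivial divisible subgroup. *)

(* Defs.v *)
From HB Require Import structures.
From mathcomp Require Import all_boot all_order all_algebra.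
From mathcomp Require Import all_classical all_reals all_analysis.
Set Implicit Arguments. Unset Strict Implicit. Unset Printing Implicit Defensive.
Import Order.TTheory GRing.Theory Num.Theory numFieldNormedType.Exports.
Local Open Scope classical_set_scope.
Local Open Scope ring_scope.

Section Homology.
Variables (R : realType) (X : topologicalType).

(** Topological notions (a Peano continuum is path connected, locally path
    connected, compact and metrizable). *)
Definition is_path_in (A : set X) (y z : X) :=
  exists g : R -> X, [/\ {within `[0%R, 1%R], continuous g},
     g 0 = y, g 1 = z & g @` `[0%R, 1%R] `<=` A].

Definition path_connected_set (A : set X) :=
  forall y z, A y -> A z -> is_path_in A y z.

Definition path_connected_space := path_connected_set setT.

Definition locally_path_connected :=
  forall (x : X) (U : set X), nbhs x U ->
    exists V : set X, [/\ open V, V x, V `<=` U & path_connected_set V].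

(** Standard simplices. Delta^1 = [0,1] (vertices 0,1);
    Delta^2 = {(s,t) | 0 <= s, 0 <= t, s + t <= 1} with vertices
    e0 = (0,0), e1 = (1,0), e2 = (0,1).  A singular simplex is represented
    by a continuous map on R (resp. R*R) which factors through a fixed
    retraction onto the simplex; this gives a unique representative of each
    continuous map Delta^n -> X. *)
Definition clamp (t : R) : R := Num.max 0 (Num.min t 1).

Definition retr2 (p : R * R) : R * R :=
  let s := Num.max 0 p.1 in let t := Num.max 0 p.2 in
  if s + t <= 1 then (s, t) else (s / (s + t), t / (s + t)).

Record simplex1 := Simplex1 {
  sim1 :> R -> X;
  sim1_cont : continuous sim1;
  sim1_canon : forall t, sim1 t = sim1 (clamp t) }.

Record simplex2 := Simplex2 {
  sim2 :> R * R -> X;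
  sim2_cont : continuous sim2;
  sim2_canon : forall p, sim2 p = sim2 (retr2 p) }.

HB.instance Definition _ := gen_eqMixin simplex1.
HB.instance Definition _ := gen_choiceMixin simplex1.
HB.instance Definition _ := gen_eqMixin simplex2.
HB.instance Definition _ := gen_choiceMixin simplex2.

(** faces of a 2-simplex: d0 = [e1,e2], d1 = [e0,e2], d2 = [e0,e1] *)
Definition is_face0 (s : simplex2) (g : simplex1) :=
  forall t, g t = s (1 - clamp t, clamp t).
Definition is_face1 (s : simplex2) (g : simplex1) :=
  forall t, g t = s (0, clamp t).
Definition is_face2 (s : simplex2) (g : simplex1) :=
  forall t, g t = s (clamp t, 0).

Definition chain1 (c : simplex1 -> int) := finite_set [set g | c g != 0].
Definition chain2 (d : simplex2 -> int) := finite_set [set s | d s != 0].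

Definition bd1 (c : simplex1 -> int) (x : X) : int :=
  \sum_(g \in [set: simplex1])
     c g * ((g 1 == x)%:R - (g 0 == x)%:R).

Definition bd2 (d : simplex2 -> int) (g : simplex1) : int :=
  \sum_(s \in [set: simplex2])
     d s * (`[< is_face0 s g >]%:R - `[< is_face1 s g >]%:R
            + `[< is_face2 s g >]%:R).

Definition cycle1 (c : simplex1 -> int) := chain1 c /\ forall x, bd1 c x = 0.
Definition boundary1 (c : simplex1 -> int) :=
  exists d, chain2 d /\ forall g, c g = bd2 d g.

Definition csub (c c' : simplex1 -> int) := fun g => c g - c' g.
Definition cscale (n : int) (c : simplex1 -> int) := fun g => n * c g.

(** T = preimage in Z_1 of tor(H_1(X));  A = H_1(X)/tor(H_1(X)) = Z_1 / T *)
Definition torsion_cycle (c : simplex1 -> int) :=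
  cycle1 c /\ exists n : nat, (0 < n)%N /\ boundary1 (cscale n%:Z c).

(** subgroups of A correspond to subsets S of Z_1 with T <= S closed under
    differences; S corresponds to a divisible subgroup of A iff every
    element of S is n-divisible modulo T inside S for all n > 0. *)
Definition divisible_subgroup_of_A (S : set (simplex1 -> int)) :=
  [/\ S `<=` cycle1, torsion_cycle `<=` S,
      (forall c c', S c -> S c' -> S (csub c c')) &
      forall c, S c -> forall n : nat, (0 < n)%N ->
        exists c', S c' /\ torsion_cycle (csub (cscale n%:Z c') c)].

(** preimage in Z_1 of Div(A), the maximal divisible subgroup of A
    (= the union, equivalently the sum, of all divisible subgroups) *)
Definition DivA (c : simplex1 -> int) :=
  exists S, divisible_subgroup_of_A S /\ S c.

(** red(A) ~= A / Div(A) = Z_1 / DivA.  Properties of this quotient: *)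
Definition lincomb (n : nat) (k : 'I_n -> int) (b : 'I_n -> simplex1 -> int)
  : simplex1 -> int := fun g => \sum_(i < n) k i * b i g.

Definition redA_free_finite_rank :=
  exists (n : nat) (b : 'I_n -> simplex1 -> int),
    [/\ forall i, cycle1 (b i),
        forall z, cycle1 z -> exists k, DivA (csub z (lincomb k b)) &
        forall k, DivA (lincomb k b) -> forall i, k i = 0].

Definition redA_card_continuum :=
  exists f : (nat -> bool) -> simplex1 -> int,
    [/\ forall u, cycle1 (f u),
        forall u v, DivA (csub (f u) (f v)) -> u = v &
        forall z, cycle1 z -> exists u, DivA (csub z (f u))].

End Homology.

(* Main.v *)
Require Import Defs.
From HB Require Import structures.
From mathcomp Require Import all_boot all_order all_algebra.
From mathcomp Require Import all_classical all_reals all_analysis.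
From mathcomp Require Import ring.
Set Implicit Arguments. Unset Strict Implicit. Unset Printing Implicit Defensive.
Import Order.TTheory GRing.Theory Num.Theory numFieldNormedType.Exports.
Local Open Scope classical_set_scope.
Local Open Scope ring_scope.

(** Write [Q] for [red(A)]; it is torsion-free and reduced.

    Suppose first that every point has a neighbourhood in which all loops at
    that point vanish in [Q]. A Lebesgue number and a finite cover by small path
    connected sets give finitely many generators: closing a short path up
    through a fixed base point yields a cycle whose class depends only on the
    cover elements containing its endpoints. A finitely generated torsion-free
    group is free.

    Otherwise some point carries arbitrarily small loops [g_n] that are nonzero
    in [Q]. As [Q] is reduced, [g_n] is not in [k_n Q] for a suitable [k_n > 0].
    For [u : nat -> bool] there are loops [L_n(u)] with
    [L_n(u) = g_n^{u_n} * L_{n+1}(u)^{k_n}]. Modulo [k_n] the class of [L_n(u)]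
    determines [u_n], and torsion-freeness then allows one to cancel [k_n] and
    pass to [L_{n+1}(u)]; so [u |-> L_0(u)] is injective into [Q]. Every class is
    represented by a loop, and there are at most continuum many loops. *)

(** * Subgroups and torsion-free quotients *)

Definition is_subgroup (V : zmodType) (P : V -> Prop) :=
  P 0 /\ forall a b, P a -> P b -> P (a - b).

Section Subgroups.
Variables (V : zmodType) (P : V -> Prop).
Hypothesis sP : is_subgroup P.

Lemma subgroupB a b : P a -> P b -> P (a - b). Proof. exact: sP.2. Qed.

Lemma subgroupN a : P a -> P (- a).
Proof. by move=> Pa; rewrite -sub0r; apply: subgroupB => //; exact: sP.1. Qed.

Lemma subgroupD a b : P a -> P b -> P (a + b).
Proof. by move=> Pa Pb; rewrite -[b]opprK; apply/subgroupB/subgroupN. Qed.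

Lemma subgroupMn a n : P a -> P (a *+ n).
Proof.
by move=> Pa; elim: n => [|n IH]; rewrite ?mulrS; [exact: sP.1|exact: subgroupD].
Qed.

Lemma subgroupMz a (k : int) : P a -> P (a *~ k).
Proof.
by case: k => n Pa; rewrite ?NegzE ?mulrNz -pmulrn; [|apply: subgroupN];
  apply: subgroupMn.
Qed.

Lemma subgroup_sum (I : eqType) (s : seq I) (F : I -> V) :
  (forall i, i \in s -> P (F i)) -> P (\sum_(i <- s) F i).
Proof.
move=> PF; rewrite big_seq; elim/big_rec: _ => [|i x si Px]; first exact: sP.1.
by apply: subgroupD => //; exact: PF.
Qed.

Lemma subgroup_transl a b : P (a - b) -> P b -> P a.
Proof. by move=> ? ?; rewrite -[a](subrK b); apply: subgroupD. Qed.

End Subgroups.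

(* Smith normal form turns a relation [\sum k_i b_i = 0] in a torsion-free
   quotient into the vanishing of one generator. *)
Lemma torsion_free_fg_basis (V : zmodType) (Z D : V -> Prop) :
    is_subgroup Z -> is_subgroup D -> (forall v, D v -> Z v) ->
    (forall v (k : int), Z v -> k != 0 -> D (v *~ k) -> D v) ->
  forall n (b : 'I_n -> V),
    (forall i, Z (b i)) ->
    (forall z, Z z -> exists k, D (z - \sum_(i < n) b i *~ k i)) ->
  exists m (c : 'I_m -> V),
    [/\ forall i, Z (c i),
        forall z, Z z -> exists k, D (z - \sum_(i < m) c i *~ k i) &
        forall k, D (\sum_(i < m) c i *~ k i) -> forall i, k i = 0].
Proof.
move=> sZ sD DZ pureD; elim=> [|n IH] b Zb genb.
  by exists 0%N, b; split=> // k _ [].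
have [indep|] := pselect (forall k, D (\sum_(i < n.+1) b i *~ k i) ->
  forall i, k i = 0); first by exists n.+1, b.
move=> /existsNP[k] /not_implyP[Dk] /existsNP[i0 /eqP ki0].
(* Smith form of the one-row matrix [k]: [Q] is unimodular, so its rows turn [b] into another
   generating family [c], and the relation becomes [c 0 *~ e]. *)
have [L _ [Q uQ [d _ kE]]] := int_Smith_normal_form (\row_i k i).
pose c j := \sum_i b i *~ Q j i.
pose e := L 0 0 * d`_0.
have kQ i : k i = e * Q 0 i.
  have := congr1 (fun M : 'M[int]_(1, n.+1) => M 0 i) kE; rewrite mxE => ->.
  rewrite !mxE (bigD1 ord0) //= big1 ?addr0 => [|j /negPf j0].
    by rewrite !mxE big_ord1 !mxE eqxx mulr1n.
  by rewrite !mxE big_ord1 !mxE -val_eqE /= in j0 *; rewrite eq_sym j0 mulr0n mulr0 mul0r.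
have e0 : e != 0 by apply: contra_neq ki0 => e0; rewrite kQ e0 mul0r.
have Zc j : Z (c j) by apply: subgroup_sum => // i _; apply: subgroupMz.
have bc i : b i = \sum_j c j *~ invmx Q i j.
  transitivity (\sum_l b l *~ ((invmx Q *m Q) i l)).
    rewrite mulVmx // (bigD1 i) //= mxE eqxx mulr1z big1 ?addr0 // => l /negPf li.
    by rewrite mxE eq_sym li mulr0z.
  under [RHS]eq_bigr => j _ do rewrite /c mulrz_suml.
  rewrite exchange_big; apply: eq_bigr => l _.
  rewrite mxE mulrz_sumr; apply: eq_bigr => j _.
  by rewrite -mulrzA mulrC.
have Dc0 : D (c 0).
  apply: (pureD _ e) => //; congr D: Dk.
  rewrite /c mulrz_suml; apply: eq_bigr => i _.
  by rewrite kQ -mulrzA mulrC.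
(* As [c 0] lies in [D], the other [n] members of [c] still generate. *)
apply: (IH (fun j => c (lift 0 j))) => [j|z /genb[h Dh]]; first exact: Zc.
pose f j := \sum_i h i * invmx Q i j.
exists (fun j => f (lift 0 j)).
have hE : \sum_i b i *~ h i = c 0 *~ f 0 + \sum_j c (lift 0 j) *~ f (lift 0 j).
  rewrite -(big_ord_recl _ (fun j => c j *~ f j)).
  under eq_bigr => i _ do rewrite bc mulrz_suml.
  rewrite exchange_big; apply: eq_bigr => j _.
  by rewrite mulrz_sumr; apply: eq_bigr => i _; rewrite -mulrzA mulrC.
move: Dh; rewrite hE opprD addrCA addrC => Dh.
by apply: (subgroup_transl sD) (subgroupMz sD (f 0) Dc0); rewrite addrAC in Dh *.
Qed.

(** * Chains and the group Div(A) *)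

Lemma fct_mulrzE (U : Type) (V : zmodType) (f : U -> V) (k : int) x :
  (f *~ k) x = f x *~ k.
Proof.
by case: k => n; rewrite ?NegzE ?mulrNz -!pmulrn ?opprfctE natmulfctE.
Qed.

Lemma subfctE (U : Type) (V : zmodType) (f g : U -> V) x : (f - g) x = f x - g x.
Proof. by []. Qed.

(** * Finitely supported integer functions *)

Section FiniteSupport.
Variable T : choiceType.
Implicit Types (c w : T -> int) (s : seq T).

Lemma finite_supportE c :
  finite_set [set g | c g != 0] <-> exists s, forall g, c g != 0 -> g \in s.
Proof.
split=> [/finite_seqP[s sE]|[s sP]]; last first.
  by apply: (@sub_finite_set _ _ [set` s]) => // g /sP.
by exists s => g cg; move: sE => /seteqP[/(_ g)/= + _]; apply.
Qed.

(** Any list containing the support can index the sum, so two chains can be compared over a common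
    list; [undup] keeps repeated entries from being counted twice. *)
Lemma fsum_support c w s : (forall g, c g != 0 -> g \in s) ->
  \sum_(g \in setT) c g * w g = \sum_(g <- undup s) c g * w g.
Proof.
move=> sP; rewrite [RHS]fsbig_seq ?undup_uniq //; symmetry.
rewrite (fsbig_widen [set` undup s] setT) // => g /= [_].
rewrite mem_undup => gs; have [->|/sP/gs//] := eqVneq (c g) 0; exact: mul0r.
Qed.

Lemma finite_supportB c c' : finite_set [set g | c g != 0] ->
  finite_set [set g | c' g != 0] -> finite_set [set g | (c - c') g != 0].
Proof.
move=> /finite_supportE[s sP] /finite_supportE[s' sP'].
apply/finite_supportE; exists (s ++ s') => g; rewrite mem_cat => ncc'.
have [c0|/sP-> //] := eqVneq (c g) 0.
have [c0'|/sP'-> //] := eqVneq (c' g) 0; last by rewrite orbT.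
by move: ncc'; rewrite subfctE c0 c0' subr0 eqxx.
Qed.

Lemma fsumB c c' w : finite_set [set g | c g != 0] ->
    finite_set [set g | c' g != 0] ->
  \sum_(g \in setT) (c - c') g * w g =
  \sum_(g \in setT) c g * w g - \sum_(g \in setT) c' g * w g.
Proof.
move=> /finite_supportE[s sP] /finite_supportE[s' sP'].
have ss' g : c g != 0 -> g \in s ++ s' by move=> /sP; rewrite mem_cat => ->.
have s's g : c' g != 0 -> g \in s ++ s' by move=> /sP'; rewrite mem_cat orbC => ->.
have D g : (c - c') g != 0 -> g \in s ++ s'.
  have [c0|/ss' //] := eqVneq (c g) 0; have [c0'|/s's //] := eqVneq (c' g) 0.
  by rewrite subfctE c0 c0' subr0 eqxx.
rewrite (fsum_support _ D) (fsum_support _ ss') (fsum_support _ s's).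
by rewrite -sumrB; apply: eq_bigr => g _; rewrite -mulrBl.
Qed.

(** The basis element of the free abelian group given by [g]. *)
Definition single (g : T) : T -> int := fun h => (g == h)%:R.

Lemma finite_support_single g : finite_set [set h | single g h != 0].
Proof.
apply/finite_supportE; exists [:: g] => h; rewrite inE /single.
by case: (eqVneq g h).
Qed.

Lemma fsum_single g w : \sum_(h \in setT) single g h * w h = w g.
Proof.
have sP h : single g h != 0 -> h \in [:: g].
  by rewrite inE /single; case: (eqVneq g h).
rewrite (fsum_support _ sP) /=.
by rewrite big_seq1 /single eqxx mul1r.
Qed.

Lemma sum_single c s : (forall g, c g != 0 -> g \in s) ->
  c = \sum_(g <- undup s) single g *~ c g.
Proof.
move=> sP; rewrite fct_sumE; apply/funext => h.
have E g : (single g *~ c g) h = c g * single g h.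
  by rewrite fct_mulrzE -mulrzr intz mulrC.
under eq_bigr => g _ do rewrite E mulrC.
have [c0|ch] := eqVneq (c h) 0.
  rewrite c0 big1_seq // => g /andP[_]; rewrite mem_undup => gs; rewrite /single.
  by case: eqP => [->|_]; rewrite ?c0 ?mulr0 ?mul0r.
rewrite (bigD1_seq h) ?mem_undup ?undup_uniq ?sP //= /single eqxx mul1r.
by rewrite big1 ?addr0 // => g /negPf; rewrite eq_sym => ->; rewrite mul0r.
Qed.

End FiniteSupport.

(** * Cycles, boundaries, torsion and divisible classes *)

Section ChainGroups.
Variables (R : realType) (X : topologicalType).
Implicit Types (c z : simplex1 R X -> int) (g : simplex1 R X).

Lemma csubE c c' : csub c c' = c - c'. Proof. by []. Qed.

Lemma cscaleE (n : int) c : Defs.cscale n c = c *~ n.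
Proof. by apply/funext => g; rewrite fct_mulrzE -mulrzr intz mulrC. Qed.

Lemma chain1B c c' : chain1 c -> chain1 c' -> chain1 (c - c').
Proof. exact: finite_supportB. Qed.

Lemma chain1_subgroup : is_subgroup (@chain1 R X).
Proof.
split; last exact: chain1B.
by apply/finite_supportE; exists [::] => g; rewrite eqxx.
Qed.

Lemma bd1B c c' x : chain1 c -> chain1 c' -> bd1 (c - c') x = bd1 c x - bd1 c' x.
Proof. exact: fsumB. Qed.

Lemma bd1_single g x : bd1 (single g) x = (g 1 == x)%:R - (g 0 == x)%:R.
Proof. exact: fsum_single. Qed.

Lemma cycle1_subgroup : is_subgroup (@cycle1 R X).
Proof.
split=> [|c c' [fc bc] [fc' bc']].
  split; first exact: chain1_subgroup.1.
  by move=> x; rewrite /bd1 fsbig1 // => g _; rewrite mul0r.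
by split=> [|x]; [exact: chain1B|rewrite bd1B // bc bc' subr0].
Qed.

Lemma cycle1_single g : g 0 = g 1 -> cycle1 (single g).
Proof.
move=> g01; split=> [|x]; first exact: finite_support_single.
by rewrite bd1_single g01 subrr.
Qed.

Lemma boundary1_subgroup : is_subgroup (@boundary1 R X).
Proof.
split=> [|c c' [d [fd cd]] [d' [fd' cd']]].
  exists 0; split; first by apply/finite_supportE; exists [::] => g; rewrite eqxx.
  by move=> g; rewrite /bd2 fsbig1 // => s _; rewrite mul0r.
exists (d - d'); split=> [|g]; first exact: finite_supportB.
by rewrite /bd2 fsumB // subfctE cd cd'.
Qed.

(** [bd2] tests every 1-simplex for being a face; the equivalences single out exactly one simplex
    per face, which makes the boundary of [single s] explicit. *)
Lemma boundary1_faces (s : simplex2 R X) (g0 g1 g2 : simplex1 R X) :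
    (forall g, is_face0 s g <-> g0 = g) -> (forall g, is_face1 s g <-> g1 = g) ->
    (forall g, is_face2 s g <-> g2 = g) ->
  boundary1 (single g0 - single g1 + single g2).
Proof.
move=> f0 f1 f2; exists (single s); split; first exact: finite_support_single.
move=> g; rewrite /bd2 fsum_single.
have E P h : (P <-> h = g) -> `[< P >] = (h == g).
  by move=> Ph; apply/asboolP/eqP => /Ph.
by rewrite (E _ _ (f0 g)) (E _ _ (f1 g)) (E _ _ (f2 g)).
Qed.

Definition null_cycle c := cycle1 c /\ boundary1 c.

Lemma null_cycle_subgroup : is_subgroup null_cycle.
Proof.
split=> [|c c' [? ?] [? ?]]; first by split; [exact: cycle1_subgroup.1|
  exact: boundary1_subgroup.1].
split; [exact: cycle1_subgroup.2|exact: boundary1_subgroup.2].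
Qed.

Lemma torsion_cycleE c :
  torsion_cycle c <-> cycle1 c /\ exists n, null_cycle (c *+ n.+1).
Proof.
split=> -[zc [n Hn]]; split=> //.
  case: n Hn => [[//]|n [_ Hn]]; exists n; split.
    exact: subgroupMn cycle1_subgroup _ _ zc.
  by rewrite cscaleE in Hn.
by exists n.+1; split=> //; rewrite cscaleE; case: Hn.
Qed.

(** The product of two annihilating multipliers annihilates the difference. Multipliers are stored
    as predecessors, whence the [.-1]. *)
Lemma torsion_subgroup : is_subgroup (@torsion_cycle R X).
Proof.
split=> [|c c' /torsion_cycleE[zc [n cn]] /torsion_cycleE[zc' [n' cn']]].
  apply/torsion_cycleE; split; first exact: cycle1_subgroup.1.
  by exists 0%N; exact: null_cycle_subgroup.1.
apply/torsion_cycleE; split; first exact: cycle1_subgroup.2.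
exists (n.+1 * n'.+1).-1; rewrite prednK ?muln_gt0 // mulrnBl.
apply: (null_cycle_subgroup.2).
  by rewrite mulrnA; apply: subgroupMn null_cycle_subgroup _ _ _.
by rewrite mulnC mulrnA; apply: subgroupMn null_cycle_subgroup _ _ _.
Qed.

Lemma torsion_pure c n : cycle1 c -> torsion_cycle (c *+ n.+1) -> torsion_cycle c.
Proof.
move=> zc /torsion_cycleE[_ [m cm]]; apply/torsion_cycleE; split=> //.
by exists (n.+1 * m.+1).-1; rewrite prednK ?muln_gt0 // mulrnA.
Qed.

Lemma null_cycle_torsion c : null_cycle c -> torsion_cycle c.
Proof. by move=> nc; apply/torsion_cycleE; split; [case: nc|exists 0%N]. Qed.

(* In the torsion-free group [A] roots are unique, so that the elements having
   all roots form the maximal divisible subgroup. *)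
Lemma DivAE c : DivA c <->
  cycle1 c /\ forall n, exists c', cycle1 c' /\ torsion_cycle (c' *+ n.+1 - c).
Proof.
split=> [[S [[SZ _ _ Sdiv] Sc]]|[zc divc]].
  split=> [|n]; first exact: SZ.
  by have [c' [/SZ]] := Sdiv c Sc n.+1 isT; rewrite csubE cscaleE; exists c'.
(* The largest candidate: all cycles that have every root modulo torsion. *)
exists [set d | cycle1 d /\
  forall n, exists c', cycle1 c' /\ torsion_cycle (c' *+ n.+1 - d)].
split; last by []; split.
- by move=> d [].
- move=> d td; split=> [|n]; first by case: td.
  exists 0; split; first exact: cycle1_subgroup.1.
  by rewrite mul0rn; apply: torsion_subgroup.2 => //; exact: torsion_subgroup.1.
- move=> d d' [zd rd] [zd' rd']; split=> [|n]; first exact: cycle1_subgroup.2.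
  have [e [ze te]] := rd n; have [e' [ze' te']] := rd' n.
  exists (e - e'); split; first exact: cycle1_subgroup.2.
  have := torsion_subgroup.2 _ _ te te'.
  by rewrite csubE mulrnBl !opprD !opprK addrACA.
- move=> d [zd rd] [//|n] _; have [e [ze te]] := rd n.
  exists e; split; last by rewrite csubE cscaleE.
  (* The root [e] has roots itself: if [f] is an [(m+1)(n+1)]-th root of [d], then [f *+ m.+1] and
     [e] are both [(n+1)]-th roots of [d], hence agree modulo torsion. *)
  split=> // m; have [f [zf tf]] := rd (m.+1 * n.+1).-1.
  exists f; split=> //; apply: (@torsion_pure _ n).
    by apply: cycle1_subgroup.2 => //; exact: subgroupMn cycle1_subgroup _ _ _.
  rewrite prednK ?muln_gt0 // mulrnA in tf.
  rewrite mulrnBl -[X in torsion_cycle X](subrKA d).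
  by rewrite -[d - _]opprB; apply: torsion_subgroup.2.
Qed.

Lemma DivA_cycle c : DivA c -> cycle1 c.
Proof. by move=> /DivAE[]. Qed.

Lemma torsion_DivA c : torsion_cycle c -> DivA c.
Proof.
move=> tc; apply/DivAE; split=> [|n]; first by case: tc.
exists 0; split; first exact: cycle1_subgroup.1.
by rewrite mul0rn; apply: torsion_subgroup.2 => //; exact: torsion_subgroup.1.
Qed.

Lemma null_cycle_DivA c : null_cycle c -> DivA c.
Proof. by move=> /null_cycle_torsion/torsion_DivA. Qed.

Lemma DivA_subgroup : is_subgroup (@DivA R X).
Proof.
split=> [|d d' /DivAE[zd rd] /DivAE[zd' rd']].
  exact/torsion_DivA/torsion_subgroup.1.
apply/DivAE; split=> [|n]; first exact: cycle1_subgroup.2.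
have [e [ze te]] := rd n; have [e' [ze' te']] := rd' n.
exists (e - e'); split; first exact: cycle1_subgroup.2.
have := torsion_subgroup.2 _ _ te te'.
by rewrite mulrnBl !opprD !opprK addrACA.
Qed.

(** An [(m+1)(n+1)]-th root of [c *+ n.+1] is an [(m+1)]-th root of [c], by uniqueness of roots
    modulo torsion. Thus the quotient by [DivA] is torsion-free. *)
Lemma DivA_pure c n : cycle1 c -> DivA (c *+ n.+1) -> DivA c.
Proof.
move=> zc /DivAE[_ rc]; apply/DivAE; split=> // m.
have [e [ze te]] := rc (m.+1 * n.+1).-1; exists e; split=> //.
apply: (@torsion_pure _ n).
  by apply: cycle1_subgroup.2 => //; exact: subgroupMn cycle1_subgroup _ _ _.
by rewrite prednK ?muln_gt0 // mulrnA in te; rewrite mulrnBl.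
Qed.

Lemma DivA_purez c (k : int) : cycle1 c -> k != 0 -> DivA (c *~ k) -> DivA c.
Proof.
move=> zc; case: k => [[//|n]|n] _; first exact: DivA_pure.
by rewrite NegzE mulrNz => /(subgroupN DivA_subgroup); rewrite opprK; exact: DivA_pure.
Qed.

(** Divisibility modulo [DivA] improves to divisibility modulo torsion: the error term lies in
    [DivA], so it has an [(n+1)]-th root, which is added to [c]. *)
Lemma redA_reduced z : cycle1 z -> ~ DivA z ->
  exists k, forall c, cycle1 c -> ~ DivA (z - c *+ k.+1).
Proof.
move=> zz; apply: contra_notP => /forallNP H; apply/DivAE; split=> // n.
have /existsNP[c /not_implyP[zc /contrapT Dc]] := H n.
have /DivAE[_ /(_ n) [e [ze te]]] := Dc.
exists (c + e); split; first exact: subgroupD cycle1_subgroup _ _ zc ze.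
by rewrite mulrnDl; congr torsion_cycle: te; rewrite opprB addrCA addrA.
Qed.

(* Since [\sum_s z s (P (s 1) - P (s 0)) = \sum_x (bd1 z x) P x = 0], every
   1-simplex of a cycle may be closed up through [P]. *)
Lemma cycle_closing (P : X -> simplex1 R X -> int) (D : (simplex1 R X -> int) -> Prop) z :
    is_subgroup D -> cycle1 z ->
    (forall s, z s != 0 -> D (single s + P (s 0) - P (s 1))) ->
  D z.
Proof.
move=> sD [fz bz] Dz; have [l0 lP] := (finite_supportE z).1 fz.
(* Only simplices with nonzero coefficient are kept, since the hypothesis on [D] covers just
   these. *)
pose l := [seq s <- undup l0 | z s != 0].
have zE : z = \sum_(s <- l) single s *~ z s.
  rewrite big_filter big_mkcond {1}(sum_single lP); apply: eq_bigr => s _.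
  by case: eqP => // ->; rewrite mulr0z.
have bE x : \sum_(s <- l) z s * ((s 1 == x)%:R - (s 0 == x)%:R) = 0.
  transitivity (bd1 z x); last exact: bz.
  rewrite /bd1 (fsum_support _ lP) big_filter big_mkcond.
  by apply: eq_bigr => s _; case: eqP => // ->; rewrite mul0r.
(* Expanding [P] over the finitely many endpoints and exchanging the sums makes the coefficient of
   each [P x] equal to [bd1 z x]. *)
pose pts := undup ([seq (s : simplex1 R X) 0 | s <- l] ++ [seq (s : simplex1 R X) 1 | s <- l]).
have PE y : y \in pts -> P y = \sum_(x <- pts) P x *~ (y == x)%:R.
  move=> ypts; rewrite (bigD1_seq y) ?undup_uniq //= eqxx mulr1z big1 ?addr0 //.
  by move=> x /negPf; rewrite eq_sym => ->; rewrite mulr0z.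
have P0 : \sum_(s <- l) (P (s 1) - P (s 0)) *~ z s = 0.
  transitivity (\sum_(x <- pts) P x *~
      \sum_(s <- l) z s * ((s 1 == x)%:R - (s 0 == x)%:R)).
    under [RHS]eq_bigr => x _ do rewrite mulrz_sumr.
    rewrite exchange_big; apply: eq_big_seq => s sl.
    have s0 : s 0 \in pts.
      by rewrite mem_undup mem_cat; apply/orP; left; apply/mapP; exists s.
    have s1 : s 1 \in pts.
      by rewrite mem_undup mem_cat; apply/orP; right; apply/mapP; exists s.
    rewrite (PE _ s0) (PE _ s1).
    rewrite -sumrB mulrz_suml; apply: eq_bigr => x _.
    by rewrite -mulrzBr -mulrzA mulrC.
  by rewrite big1 // => x _; rewrite bE mulr0z.
have -> : z = \sum_(s <- l) (single s + P (s 0) - P (s 1)) *~ z s.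
  transitivity (\sum_(s <- l) single s *~ z s - \sum_(s <- l) (P (s 1) - P (s 0)) *~ z s).
    by rewrite P0 subr0.
  rewrite -sumrB; apply: eq_bigr => s _.
  by rewrite -mulrzBl opprB addrA.
apply: subgroup_sum => // s; rewrite mem_filter => /andP[zs _].
by apply: subgroupMz => //; exact: Dz.
Qed.

End ChainGroups.

(** * Paths and their homology relations *)

Section Clamp.
Variable R : realType.
Implicit Types (t : R) (p : R * R).

Lemma clamp_ge0 t : 0 <= clamp t.
Proof. by rewrite /clamp le_max lexx. Qed.

Lemma clamp_le1 t : clamp t <= 1.
Proof. by rewrite /clamp ge_max ler01 ge_min lexx orbT. Qed.

Lemma clamp_id t : 0 <= t -> t <= 1 -> clamp t = t.
Proof. by move=> t0 t1; rewrite /clamp (min_idPl t1) (max_idPr t0). Qed.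

Lemma clampK t : clamp (clamp t) = clamp t.
Proof. by rewrite clamp_id ?clamp_ge0 ?clamp_le1. Qed.

Lemma clamp0 : clamp (0 : R) = 0. Proof. by rewrite clamp_id ?ler01. Qed.

Lemma clamp1 : clamp (1 : R) = 1. Proof. by rewrite clamp_id ?ler01. Qed.

Lemma clamp_neg t : t <= 0 -> clamp t = 0.
Proof. by move=> t0; rewrite /clamp (max_idPl _) // ge_min t0. Qed.

Lemma clamp_gt1 t : 1 <= t -> clamp t = 1.
Proof. by move=> t1; rewrite /clamp (min_idPr t1) (max_idPr ler01). Qed.

Lemma clamp_continuous : continuous (@clamp R).
Proof.
move=> t; apply: (@continuous_max _ _ (fun=> 0) (fun t => Num.min t 1) t).
  exact: cvg_cst.
by apply: (@continuous_min _ _ id (fun=> 1) t); [exact: cvg_id|exact: cvg_cst].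
Qed.

(** A formula without case distinction, from which continuity of [retr2] follows by that of maximum,
    sum, product and inverse. *)
Lemma retr2E p : let s := Num.max 0 p.1 in let t := Num.max 0 p.2 in
  retr2 p = (s / Num.max 1 (s + t), t / Num.max 1 (s + t)).
Proof.
rewrite /retr2 /=; set s := Num.max 0 _; set t := Num.max 0 _.
case: leP => [st|st]; first by rewrite !divr1.
by [].
Qed.

Lemma retr2_id p : 0 <= p.1 -> 0 <= p.2 -> p.1 + p.2 <= 1 -> retr2 p = p.
Proof.
move=> p1 p2 p12; rewrite /retr2 (max_idPr p1) (max_idPr p2) p12.
by case: p {p1 p2 p12}.
Qed.

Lemma retr2K p : retr2 (retr2 p) = retr2 p.
Proof.
have s0 : 0 <= Num.max 0 p.1 by rewrite le_max lexx.
have t0 : 0 <= Num.max 0 p.2 by rewrite le_max lexx.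
rewrite [retr2 p]retr2E /=; set s := Num.max 0 p.1 in s0 *.
set t := Num.max 0 p.2 in t0 *; set m := Num.max 1 _.
have m0 : 0 < m by rewrite lt_max ltr01.
rewrite retr2_id //= ?divr_ge0 ?(ltW m0) //.
by rewrite -mulrDl ler_pdivrMr // mul1r le_max lexx orbT.
Qed.

Lemma retr2_continuous : continuous (@retr2 R).
Proof.
have c1 : continuous (fun p : R * R => Num.max 0 p.1).
  move=> p; apply: (@continuous_max _ _ (fun=> 0) (fun p : R * R => p.1) p).
    exact: cvg_cst.
  exact: cvg_fst.
have c2 : continuous (fun p : R * R => Num.max 0 p.2).
  move=> p; apply: (@continuous_max _ _ (fun=> 0) (fun p : R * R => p.2) p).
    exact: cvg_cst.
  exact: cvg_snd.
have cm : continuous (fun p : R * R => Num.max 1 (Num.max 0 p.1 + Num.max 0 p.2)).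
  move=> p; apply: (@continuous_max _ _ (fun=> 1)
    (fun p : R * R => Num.max 0 p.1 + Num.max 0 p.2) p); first exact: cvg_cst.
  by apply: (@continuousD R R^o (R * R)%type); [exact: c1|exact: c2].
have cV : continuous (fun p : R * R => (Num.max 1 (Num.max 0 p.1 + Num.max 0 p.2))^-1).
  move=> p; apply: (@continuousV R (R * R)%type); last exact: cm.
  by rewrite gt_eqF // lt_max ltr01.
rewrite (funext retr2E) => p /=.
have h1 := @continuousM R (R * R)%type _ _ p (c1 p) (cV p).
have h2 := @continuousM R (R * R)%type _ _ p (c2 p) (cV p).
exact: (cvg_pair h1 h2).
Qed.

End Clamp.

(** * Segments of a path and the triangle relation *)

Section Segments.
Variables (R : realType) (X : topologicalType).
Implicit Types (f : R -> X) (g h : simplex1 R X).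

Lemma chain1_single g : chain1 (single g).
Proof. exact: finite_support_single. Qed.

Lemma chain1D (c c' : simplex1 R X -> int) : chain1 c -> chain1 c' -> chain1 (c + c').
Proof. by apply: subgroupD; exact: chain1_subgroup. Qed.

Lemma bd1D (c c' : simplex1 R X -> int) x : chain1 c -> chain1 c' ->
  bd1 (c + c') x = bd1 c x + bd1 c' x.
Proof.
move=> fc fc'; have := @bd1B _ _ (c + c') c' x (chain1D fc fc') fc'.
by rewrite addrK => ->; rewrite subrK.
Qed.

Lemma simplex1P g h : (forall t, g t = h t) <-> g = h.
Proof.
split=> [|-> //]; case: g h => [g gc gK] [h hc hK] /= /funext gh.
by subst h; congr Simplex1; exact: Prop_irrelevance.
Qed.

Lemma seg_cont f (fc : continuous f) (a b : R) :
  continuous (fun t => f (a + (b - a) * clamp t)).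
Proof.
move=> t; apply: (@continuous_comp _ _ _ (fun t => a + (b - a) * clamp t) f); last exact: fc.
apply: (@continuousD R R^o R); first exact: cvg_cst.
by apply: (@continuousM R R); [exact: cvg_cst|exact: clamp_continuous].
Qed.

Lemma seg_canon f (a b t : R) :
  f (a + (b - a) * clamp t) = f (a + (b - a) * clamp (clamp t)).
Proof. by rewrite clampK. Qed.

(** The stretch of [f] from parameter [a] to [b], run linearly; [b < a] is allowed and reverses the
    direction. *)
Definition seg f (fc : continuous f) (a b : R) : simplex1 R X :=
  Simplex1 (@seg_cont f fc a b) (seg_canon f a b).

Lemma seg0 f (fc : continuous f) a b : seg fc a b 0 = f a.
Proof. by rewrite /= clamp0 mulr0 addr0. Qed.

Lemma seg1 f (fc : continuous f) a b : seg fc a b 1 = f b.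
Proof. by rewrite /= clamp1 mulr1 addrC subrK. Qed.

Lemma seg_id g : seg (@sim1_cont _ _ g) 0 1 = g.
Proof. by apply/simplex1P => t /=; rewrite add0r subr0 mul1r -sim1_canon. Qed.

Lemma tri_cont f (fc : continuous f) (a b c : R) : continuous (fun p : R * R =>
  f (a + (b - a) * (retr2 p).1 + (c - a) * (retr2 p).2)).
Proof.
move=> p; apply: (@continuous_comp _ _ _ (fun p : R * R =>
  a + (b - a) * (retr2 p).1 + (c - a) * (retr2 p).2) f); last exact: fc.
have r1 : {for p, continuous (fun p : R * R => (retr2 p).1)}.
  by apply: (continuous_comp (retr2_continuous (x:=p))); exact: cvg_fst.
have r2 : {for p, continuous (fun p : R * R => (retr2 p).2)}.
  by apply: (continuous_comp (retr2_continuous (x:=p))); exact: cvg_snd.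
apply: (@continuousD R R^o (R * R)%type); last first.
  by apply: (@continuousM R (R * R)%type); [exact: cvg_cst|].
apply: (@continuousD R R^o (R * R)%type); first exact: cvg_cst.
by apply: (@continuousM R (R * R)%type); [exact: cvg_cst|].
Qed.

Lemma tri_canon f (a b c : R) (p : R * R) :
  f (a + (b - a) * (retr2 p).1 + (c - a) * (retr2 p).2) =
  f (a + (b - a) * (retr2 (retr2 p)).1 + (c - a) * (retr2 (retr2 p)).2).
Proof. by rewrite retr2K. Qed.

Definition tri f (fc : continuous f) (a b c : R) : simplex2 R X :=
  Simplex2 (@tri_cont f fc a b c) (tri_canon f a b c).

(** The affine map from the triangle to the line with vertex values [a], [b], [c], followed by [f],
    has these segments as its faces. The relations for constant, reversed and concatenated paths are
    all instances. *)
Lemma seg_triangle f (fc : continuous f) (a b c : R) :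
  null_cycle (single (seg fc a b) + single (seg fc b c) - single (seg fc a c)).
Proof.
have E : single (seg fc a b) + single (seg fc b c) - single (seg fc a c) =
    single (seg fc b c) - single (seg fc a c) + single (seg fc a b).
  by rewrite [RHS]addrC addrA.
split.
  have fs := chain1_single; split=> [|x]; first by apply/chain1B/fs/chain1D.
  rewrite bd1B ?bd1D ?bd1_single ?seg0 ?seg1 //; first ring; exact: chain1D.
rewrite E; apply: (@boundary1_faces _ _ (tri fc a b c)) => g; rewrite -simplex1P.
- split=> H t; have := H t;
    rewrite /= retr2_id /= ?clamp_ge0 ?subr_ge0 ?clamp_le1 ?subrK //;
  by rewrite (_ : a + _ + _ = b + (c - b) * clamp t); last by ring.
- by split=> H t; have := H t; rewrite /= retr2_id /= ?clamp_ge0 ?add0r ?clamp_le1 // mulr0 addr0.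
- by split=> H t; have := H t; rewrite /= retr2_id /= ?clamp_ge0 ?addr0 ?clamp_le1 // mulr0 addr0.
Qed.

End Segments.

Section PathAlgebra.
Variables (R : realType) (X : topologicalType).
Implicit Types (f : R -> X) (g h : simplex1 R X).

Lemma seg_refl f (fc : continuous f) a : null_cycle (single (seg fc a a)).
Proof. by have := seg_triangle fc a a a; rewrite addrK. Qed.

Lemma seg_rev f (fc : continuous f) a b :
  null_cycle (single (seg fc a b) + single (seg fc b a)).
Proof.
exact: subgroup_transl (@null_cycle_subgroup R X) _ _ (seg_triangle fc a b a) (seg_refl fc a).
Qed.

(** Telescoping: the closing chains at inner division points cancel. *)
Lemma seg_subdivision f (fc : continuous f) (P : X -> simplex1 R X -> int)
    (D : (simplex1 R X -> int) -> Prop) (t : nat -> R) n :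
    is_subgroup D -> (forall c, null_cycle c -> D c) ->
    (forall i, (i < n)%N -> D (single (seg fc (t i) (t i.+1)) + P (f (t i)) - P (f (t i.+1)))) ->
  D (single (seg fc (t 0) (t n)) + P (f (t 0)) - P (f (t n))).
Proof.
move=> sD nD; elim: n => [|n IH] Dt.
  by rewrite addrK; exact/nD/seg_refl.
have D1 : D (single (seg fc (t 0) (t n)) + P (f (t 0)) - P (f (t n))).
  by apply: IH => i ni; apply: Dt; rewrite ltnS ltnW.
have D2 := subgroupD sD D1 (Dt n (ltnSn n)).
have D3 := sD.2 _ _ D2 (nD _ (seg_triangle fc (t 0) (t n) (t n.+1))).
congr D: D3; set a := single (seg fc (t 0) (t n)); set b := single (seg fc (t n) _).
set c := single (seg fc (t 0) _); set p := P (f (t 0)); set q := P (f (t n)).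
set r := P (f _).
by apply/funext => s; rewrite !(subfctE, addrfctE, opprfctE); ring.
Qed.

(** A path continuous only within the unit interval is extended to the line by composing with
    [clamp]. *)
Lemma path_simplex (A : set X) y z : is_path_in R A y z ->
  exists g : simplex1 R X, [/\ g 0 = y, g 1 = z & forall t, A (g t)].
Proof.
move=> [g [gc g0 g1 gA]].
have cc : continuous (g \o @clamp R).
  move/subspace_continuousP : gc => gc t U /= Ut.
  have cI (s : R) : `[0%R, 1%R]%classic (clamp s).
    by rewrite /= in_itv /= clamp_ge0 clamp_le1.
  have W := @clamp_continuous R t _ (gc _ (cI t) _ Ut).
  by apply: (@filterS _ (nbhs t)) W => s /= Us; exact: Us (cI s).
exists (seg cc 0 1); rewrite seg0 seg1 /= clamp0 clamp1; split=> // t.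
by apply: gA; exists (clamp (0 + (1 - 0) * clamp t)) => //=; rewrite in_itv /= clamp_ge0 clamp_le1.
Qed.

End PathAlgebra.

(** * Concatenation, reversal and the replacement of cycles by loops *)

Section Concatenation.
Variables (R : realType) (X : pseudoMetricType R).
Implicit Types (f F : R -> X) (g h : simplex1 R X).

(** Continuity at one fixed scale [e]. For infinitely nested loops each scale is treated by a finite
    induction. *)
Definition osc_le (e : R) f := forall t, \forall s \near t, ball (f t) e (f s).

Lemma continuous_osc f : continuous f <-> forall e, 0 < e -> osc_le e f.
Proof.
split=> [fc e e0 t|H t]; first exact: (fc t _ (nbhsx_ballx (f t) e e0)).
by apply/cvg_ballP => e e0; exact: H.
Qed.

(** Concatenation without rescaling: [F] starts at time 1, so iterating places successive paths on
    successive unit intervals. *)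
Definition conc f F : R -> X := fun t => if t <= 1 then f t else F (t - 1).

Lemma concl f F t : t <= 1 -> conc f F t = f t.
Proof. by rewrite /conc => ->. Qed.

Lemma concr f F t : 1 < t -> conc f F t = F (t - 1).
Proof. by rewrite /conc => /lt_geF ->. Qed.

Lemma conc_osc e f F : 0 < e -> osc_le e f -> osc_le e F ->
    (forall t, 1 <= t -> f t = f 1) -> (forall t, t <= 0 -> F t = F 0) ->
    f 1 = F 0 ->
  osc_le e (conc f F).
Proof.
move=> e0 fe Fe f1 F0 fF t.
have Fe' : \forall s \near t, ball (F (t - 1)) e (F (s - 1)).
  have shift_cont : (fun s : R => s - 1) @ t --> t - 1.
    by apply: (@cvgB _ R^o); [exact: cvg_id|exact: cvg_cst].
  exact: (shift_cont _ (Fe (t - 1))).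
have [t1|t1|t1] := ltgtP t 1.
- near=> s; rewrite (concl _ _ (ltW t1)) concl; first by near: s; exact: fe.
  by apply: ltW; near: s; exact: lt_nbhsl.
- near=> s; rewrite (concr _ _ t1) concr; first by near: s; exact: Fe'.
  by near: s; exact: lt_nbhsr.
- near=> s; rewrite {1}t1 concl // -{1}t1; case: (leP s 1) => s1.
    by rewrite concl //; near: s; exact: fe.
  have <- : F (t - 1) = f t by rewrite t1 subrr.
  by rewrite concr //; near: s; exact: Fe'.
Unshelve. all: by end_near. Qed.

Lemma simplex1_const g : (forall t, t <= 0 -> g t = g 0) /\ (forall t, 1 <= t -> g t = g 1).
Proof.
by split=> t t01; rewrite [LHS]sim1_canon ?(clamp_neg t01) ?(clamp_gt1 t01).
Qed.

(** Both simplices are segments of the single map [conc g h], over [[0,1]] and [[1,2]], so the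
    triangle relation at 0, 1, 2 applies. *)
Lemma simplex1_cat g h : g 1 = h 0 ->
  exists k : simplex1 R X, [/\ k 0 = g 0, k 1 = h 1,
    forall A : set X, (forall t, A (g t)) -> (forall t, A (h t)) -> forall t, A (k t) &
    null_cycle (single g + single h - single k)].
Proof.
move=> gh.
have cc : continuous (conc g h).
  apply/continuous_osc => e e0; apply: conc_osc => //.
  - by have /continuous_osc := @sim1_cont _ _ g; apply.
  - by have /continuous_osc := @sim1_cont _ _ h; apply.
  - exact: (simplex1_const g).2.
  - exact: (simplex1_const h).1.
exists (seg cc 0 2); rewrite seg0 seg1 /conc ler01 lern1 /=; split=> //.
- by rewrite (_ : 2 - 1 = 1) //; ring.
- by move=> A Ag Ah t; rewrite /seg /=; case: ifP.
have gE : seg cc 0 1 = g.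
  apply/simplex1P => t /=; rewrite add0r subr0 mul1r /conc clamp_le1.
  by rewrite [RHS]sim1_canon.
have hE : seg cc 1 2 = h.
  apply/simplex1P => t /=; rewrite (_ : 1 + _ = 1 + clamp t); last by ring.
  rewrite /conc gerDl; case: leP => [c0|_]; last by rewrite addrC addKr -sim1_canon.
  have -> : clamp t = 0 by apply/eqP; rewrite eq_le c0 clamp_ge0.
  rewrite addr0 gh sim1_canon [RHS]sim1_canon; congr (h _).
  by rewrite clamp0; apply/esym/eqP; rewrite eq_le c0 clamp_ge0.
by have := seg_triangle cc 0 1 2; rewrite gE hE.
Qed.

Lemma simplex1_rev g : exists k : simplex1 R X, [/\ k 0 = g 1, k 1 = g 0,
    forall A : set X, (forall t, A (g t)) -> forall t, A (k t) &
    null_cycle (single g + single k)].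
Proof.
exists (seg (@sim1_cont _ _ g) 1 0); rewrite seg0 seg1; split=> // [A Ag t|]; first exact: Ag.
by have := seg_rev (@sim1_cont _ _ g) 0 1; rewrite seg_id.
Qed.

Lemma simplex1_cst (x : X) : exists k : simplex1 R X,
  (forall t, k t = x) /\ null_cycle (single k).
Proof.
have cc : continuous (fun _ : R => x) by move=> t; exact: cvg_cst.
by exists (seg cc 0 0); split=> //; exact: seg_refl.
Qed.

(** Chains homologous to a loop at [x] inside [V] form a subgroup. Every simplex of [z], closed up
    by paths in [V] from [x], belongs to it, and [cycle_closing] then gives [z]. *)
Lemma cycle_loop (V : set X) (x : X) (z : simplex1 R X -> int) :
    path_connected_set R V -> V x -> cycle1 z ->
    (forall s, z s != 0 -> forall t, V (s t)) ->
  exists k : simplex1 R X,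
    [/\ k 0 = x, k 1 = x, forall t, V (k t) & null_cycle (z - single k)].
Proof.
move=> Vpc Vx zz zV.
(* Outside [V] a constant simplex serves as default, so that [q] is total. *)
have path y : exists q : simplex1 R X, V y ->
    [/\ q 0 = x, q 1 = y & forall t, V (q t)].
  have [Vy|] := pselect (V y); last by have [k _] := simplex1_cst x; exists k.
  by have [q qP] := path_simplex (Vpc _ _ Vx Vy); exists q.
have [q qP] := choice path.
have sN := @null_cycle_subgroup R X.
pose D (c : simplex1 R X -> int) := exists k : simplex1 R X,
  [/\ k 0 = x, k 1 = x, forall t, V (k t) & null_cycle (c - single k)].
apply: (@cycle_closing _ _ (fun y => single (q y)) D) => //.
  split=> [|c c' [k [k0 k1 kV kc]] [k' [k'0 k'1 k'V k'c]]].
    have [k [kx kN]] := simplex1_cst x; exists k; split=> // [t|]; first by rewrite kx.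
    by rewrite sub0r; apply: subgroupN.
  have [r [r0 r1 rV rN]] := simplex1_rev k'.
  have [|m [m0 m1 mV mN]] := @simplex1_cat k r; first by rewrite k1 r0.
  exists m; rewrite m0 m1 k0 r1; split=> //; first by apply: mV => //; exact: rV.
  have := subgroupD sN (sN.2 _ _ (sN.2 _ _ kc k'c) rN) mN.
  congr null_cycle; apply/funext => s; rewrite !(subfctE, addrfctE, opprfctE); ring.
move=> s /zV sV.
have [q00 q01 q0V] := qP _ (sV 0); have [q10 q11 q1V] := qP _ (sV 1).
have [r [r0 r1 rV rN]] := simplex1_rev (q (s 1)).
have [|m [m0 m1 mV mN]] := @simplex1_cat (q (s 0)) s; first by rewrite q01.
have [|k [k0 k1 kV kN]] := @simplex1_cat m r; first by rewrite m1 r0.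
exists k; rewrite k0 k1 m0 r1; split=> //.
  by apply: kV; [exact: mV|exact: rV].
have := sN.2 _ _ (subgroupD sN kN mN) rN.
congr null_cycle; apply/funext => t; rewrite !(subfctE, addrfctE, opprfctE); ring.
Qed.

End Concatenation.

(** * Finite generation in the absence of small essential loops *)

Section FiniteGeneration.
Variables (R : realType) (X : pseudoMetricType R).
Implicit Types (s g : simplex1 R X) (c z : simplex1 R X -> int).

Definition supported_in (V : set X) c := forall s, c s != 0 -> forall t, V (s t).

Lemma supported_subgroup V : is_subgroup (supported_in V).
Proof.
split=> [s|c c' cV c'V s]; first by rewrite eqxx.
rewrite subfctE; have [c0|/cV //] := eqVneq (c s) 0.
have [c'0|/c'V //] := eqVneq (c' s) 0.
by rewrite c0 c'0 subrr eqxx.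
Qed.

Lemma supported_single (V : set X) s : (forall t, V (s t)) -> supported_in V (single s).
Proof. by move=> Vs g; rewrite /single; have [<- _|] := eqVneq s g. Qed.

(** Uniform continuity from compactness of the unit interval; the modulus [1/(n+1)] fits a division
    into [n+1] equal parts. *)
Lemma simplex1_uniform s (e : R) : 0 < e ->
  exists n : nat, forall t u : R, 0 <= t <= 1 -> `|u - t| <= n.+1%:R^-1 -> ball (s t) e (s u).
Proof.
move=> e0; have /compact_near_coveringP := @segment_compact R 0 1.
pose P (n : nat) (t : R) := forall u : R, `|u - t| <= n.+1%:R^-1 -> ball (s t) e (s u).
move=> /(_ nat \oo P _) [|n _ /(_ n (leqnn n)) H]; last first.
  by exists n => t u t01; apply: H; rewrite /= in_itv.
move=> t _; have e2 : 0 < e / 2 by rewrite divr_gt0.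
have /nbhs_ballP[d /= d0 dP] := @sim1_cont _ _ s t _ (nbhsx_ballx (s t) _ e2).
have d2 : 0 < d / 2 by rewrite divr_gt0.
exists (ball t (d / 2), [set n | n.+1%:R^-1 < d / 2]) => /=; first split.
- exact: nbhsx_ballx.
- exact: near_infty_natSinv_lt (PosNum d2).
move=> [t' n] /= [tt' nd] u ut'; apply: (ball_splitr (z := s t)); apply: dP.
  by apply: le_ball tt'; rewrite ler_pdivrMr // ler_peMr ?ler1n // ltW.
rewrite (splitr d); apply: ball_triangle tt' _.
by rewrite /ball /= distrC; exact: le_lt_trans ut' nd.
Qed.

Hypothesis Xc : compact [set: X].
Hypothesis Xlpc : locally_path_connected R X.
Hypothesis small_DivA : forall x : X, exists U : set X, nbhs x U /\
  forall k : simplex1 R X, k 0 = x -> k 1 = x -> (forall t, U (k t)) -> DivA (single k).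

(** A Lebesgue number. Near [x], a sufficiently small ball lies in a path connected [V] inside [U];
    a cycle there is homologous to a loop at [x] in [V], whose class is in [DivA]. Compactness makes
    the radius uniform. *)
Lemma lebesgue_DivA : exists2 e : R, 0 < e &
  forall x z, cycle1 z -> supported_in (ball x e) z -> DivA z.
Proof.
have /compact_near_coveringP := Xc.
pose P (e : R) (x : X) := forall z, cycle1 z -> supported_in (ball x e) z -> DivA z.
move=> cov.
suff H : \forall e \near 0^'+, [set: X] `<=` P e.
  near (0 : R)^'+ => e; exists e; first by near: e; exact: nbhs_right_gt.
  have He : [set: X] `<=` P e by near: e; exact: H.
  by move=> x; exact: He.
apply: cov => x _.
have [U [Ux UD]] := small_DivA x.
have [V [Vo Vx VU Vpc]] := Xlpc Ux.
have /nbhs_ballP[d /= d0 dP] := open_nbhs_nbhs (conj Vo Vx).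
have d2 : 0 < d / 2 by rewrite divr_gt0.
exists (ball x (d / 2), [set e | e < d / 2]) => /=; first split.
- exact: nbhsx_ballx.
- exact: nbhs_right_lt.
move=> [y e] /= [xy ed] z zz zs.
have zV s : z s != 0 -> forall t, V (s t).
  move=> /zs sy t; apply: dP; rewrite (splitr d); apply: ball_triangle xy _.
  exact: le_ball (ltW ed) _ (sy t).
have [k [k0 k1 kV kN]] := cycle_loop Vpc Vx zz zV.
apply: (subgroup_transl (@DivA_subgroup R X) (null_cycle_DivA kN)).
by apply: UD => // t; exact/VU/kV.
Unshelve. all: by end_near. Qed.

(** [D] lists finitely many centres, and [i y] selects one whose set [W (i y)] contains [y]. *)
Lemma small_cover (e : R) : 0 < e -> exists (D : seq X) (i : X -> X) (W : X -> set X),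
  [/\ forall y, i y \in D, forall y, W (i y) y, forall x, W x x,
      forall x, path_connected_set R (W x) &
      forall x u v, W x u -> W x v -> ball u e v].
Proof.
move=> e0; have e2 : 0 < e / 2 by rewrite divr_gt0.
have [W WP] := choice (fun x => Xlpc (nbhsx_ballx x _ e2)).
have [D DW] : exists D : seq X, forall y, exists2 x, x \in D & W x y.
  (* The filter of properties holding for all sufficiently large lists turns the near-covering form
     of compactness into a finite subcover. *)
  pose F : set_system (seq X) := [set A : set (seq X) |
    exists l : seq X, forall m : seq X, {subset l <= m} -> A m].
  have FF : Filter F.
    split; first by exists [::].
    - move=> A B [l lA] [l' l'B]; exists (l ++ l') => m lm.
      by split; [apply: lA|apply: l'B] => x xl; apply: lm; rewrite mem_cat xl ?orbT.
    - by move=> A B AB [l lA]; exists l => m /lA/AB.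
  have /compact_near_coveringP cov := Xc.
  have [|l lP] := cov _ F (fun l y => exists2 x, x \in l & W x y) FF.
    move=> x _; exists (W x, [set l : seq X | x \in l]) => [|[y l] /= [xy xl]].
      split=> /=; first by have [Wo Wx _ _] := WP x; exact: open_nbhs_nbhs.
      by exists [:: x] => m; apply; rewrite inE.
    by exists x.
  by exists l => y; apply: (lP l).
have /choice[i iP] : forall y, exists x, x \in D /\ W x y.
  by move=> y; have [x xD xy] := DW y; exists x.
exists D, i, W; split; try by move=> y; case: (iP y).
- by move=> x; case: (WP x).
- by move=> x; case: (WP x).
- move=> x u v; case: (WP x) => _ _ Wb _ /Wb xu /Wb xv.
  by rewrite (splitr e); apply: ball_triangle (ball_sym xu) xv.
Qed.

Hypothesis Xpc : path_connected_space R X.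

Lemma redA_finitely_generated : exists n (b : 'I_n -> simplex1 R X -> int),
  (forall i, cycle1 (b i)) /\
  forall z, cycle1 z -> exists k, DivA (z - \sum_(i < n) b i *~ k i).
Proof.
(* The empty space is treated apart, as a base point is chosen below. *)
have [[x0 _]|noX] := pselect (exists x : X, True); last first.
  exists 0%N, (fun=> 0); split=> [[//]|z zz]; exists (fun=> 0).
  rewrite big_ord0 subr0 (_ : z = 0); first exact: (@DivA_subgroup R X).1.
  by apply/funext => s; case: noX; exists (s 0).
have [d d0 dD] := lebesgue_DivA.
pose e := d / 2; have e0 : 0 < e by rewrite divr_gt0.
have [D [i [W [iD iW Wx Wpc Wb]]]] := small_cover e0.
have /choice[p pP] : forall y, exists p : simplex1 R X,
    [/\ p 0 = i y, p 1 = y & forall t, W (i y) (p t)].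
  by move=> y; apply: path_simplex; exact: Wpc.
have /choice[a aP] : forall y, exists a : simplex1 R X, a 0 = x0 /\ a 1 = y.
  move=> y; have [q [q0 q1 _]] := path_simplex (@Xpc x0 y I I).
  by exists q.
(* From [x0] to the centre [i y], then inside [W (i y)] to [y]: only the second piece depends on
   more than the cover element. *)
pose P y := single (a (i y)) + single (p y).
pose cl s := single s + P (s 0) - P (s 1).
have chP y : chain1 (P y) by apply: chain1D; exact: chain1_single.
have bdP y x : bd1 (P y) x = (y == x)%:R - (x0 == x)%:R.
  rewrite bd1D ?bd1_single; try exact: chain1_single.
  by have [-> ->] := aP (i y); have [-> -> _] := pP y; ring.
have cycl s : cycle1 (cl s).
  have c1 := chain1D (chain1_single s) (chP (s 0)).
  split=> [|x]; first exact: chain1B.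
  by rewrite bd1B // bd1D ?bd1_single ?bdP //; [ring|exact: chain1_single].
pose short s := forall t, ball (s 0) e (s t).
(* The long arcs [a] cancel in the difference; the six remaining pieces lie within [d] of [s 0],
   where [lebesgue_DivA] applies. *)
have short_eq s g : short s -> short g -> i (s 0) = i (g 0) -> i (s 1) = i (g 1) ->
    DivA (cl s - cl g).
  move=> ss sg i0 i1; apply: (dD (s 0)).
    exact: (@cycle1_subgroup R X).2.
  have [_ _ p0] := pP (s 0); have [_ _ p1] := pP (s 1).
  have [_ _ p0'] := pP (g 0); have [_ _ p1'] := pP (g 1).
  have bd u v : ball (s 0) e u -> ball u e v -> ball (s 0) d v.
    by rewrite (splitr d); exact: ball_triangle.
  have be v : ball (s 0) e v -> ball (s 0) d v.
    by apply: le_ball; rewrite /e ler_pdivrMr // ler_peMr ?ler1n // ltW.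
  have sS := supported_subgroup (ball (s 0) d).
  have -> : cl s - cl g = single s + single (p (s 0)) - single (p (s 1)) -
      (single g + single (p (g 0)) - single (p (g 1))).
    rewrite /cl /P i0 i1; apply/funext => h.
    by rewrite !(subfctE, addrfctE, opprfctE); ring.
  have g0 : ball (s 0) e (g 0) by apply: (Wb (i (s 0))) => //; rewrite i0.
  have h1 : supported_in (ball (s 0) d) (single s).
    by apply: supported_single => t; apply: be; exact: ss.
  have h2 : supported_in (ball (s 0) d) (single (p (s 0))).
    by apply: supported_single => t; apply: be; exact: (Wb (i (s 0))).
  have h3 : supported_in (ball (s 0) d) (single (p (s 1))).
    by apply: supported_single => t; apply: (bd _ _ (ss 1)); exact: (Wb (i (s 1))).
  have h4 : supported_in (ball (s 0) d) (single g).
    by apply: supported_single => t; apply: (bd _ _ g0); exact: sg.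
  have h5 : supported_in (ball (s 0) d) (single (p (g 0))).
    by apply: supported_single => t; apply: be; apply: (Wb (i (s 0))); rewrite // i0.
  have h6 : supported_in (ball (s 0) d) (single (p (g 1))).
    by apply: supported_single => t; apply: (bd _ _ (ss 1)); apply: (Wb (i (s 1))); rewrite // i1.
  exact: (sS.2 _ _ (sS.2 _ _ (subgroupD sS h1 h2) h3)
    (sS.2 _ _ (subgroupD sS h4 h5) h6)).
(* One short simplex is chosen for each pair of cover elements; pairs that no short simplex realises
   get the default [a x0]. *)
have /choice[G GP] : forall q : X * X, exists g, forall s, short s ->
    q = (i (s 0), i (s 1)) ->
    [/\ short g, i (s 0) = i (g 0) & i (s 1) = i (g 1)].
  move=> q.
  have [[g [gs gq]]|noq] := pselect (exists g, short g /\ q = (i (g 0), i (g 1))).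
    by exists g => s _; rewrite gq => -[-> ->].
  by exists (a x0) => s ss qs; case: noq; exists s.
pose r := undup (allpairs pair D D).
pose span c := exists k : X * X -> int, DivA (c - \sum_(q <- r) cl (G q) *~ k q).
have sspan : is_subgroup span.
  split=> [|c c' [k kc] [k' kc']].
    exists (fun=> 0); rewrite big1 ?subr0; first exact: (@DivA_subgroup R X).1.
    by move=> q _; rewrite mulr0z.
  exists (fun q => k q - k' q).
  under eq_bigr => q _ do rewrite mulrzBr.
  rewrite sumrB; have := (@DivA_subgroup R X).2 _ _ kc kc'.
  by congr DivA; apply/funext => h; rewrite !(subfctE, addrfctE, opprfctE); ring.
have Dspan c : DivA c -> span c.
  by exists (fun=> 0); rewrite big1 ?subr0 // => q _; rewrite mulr0z.
have clspan s : short s -> span (cl s).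
  move=> ss; pose q := (i (s 0), i (s 1)).
  have [Gs G0 G1] := GP q s ss erefl.
  exists (fun q' => (q' == q)%:R); rewrite (bigD1_seq q) ?undup_uniq //=; last first.
    by rewrite mem_undup allpairs_f.
  by rewrite eqxx mulr1z big1 ?addr0 => [|q' /negPf ->]; [exact: short_eq|rewrite mulr0z].
have genspan z : cycle1 z -> span z.
  move=> zz; apply: (cycle_closing (P := P)) => // s _.
  (* Division of [s] into [n+1] short segments, each closing up to an element of the span. *)
  have [n nP] := simplex1_uniform s e0.
  pose t (j : nat) : R := j%:R / n.+1%:R.
  have n0 : n.+1%:R != 0 :> R by rewrite pnatr_eq0.
  have t0 : t 0%N = 0 by rewrite /t mulr0n mul0r.
  have t1 : t n.+1 = 1 by rewrite /t divff.
  have := @seg_subdivision _ _ _ (@sim1_cont _ _ s) P span t n.+1 sspan.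
  rewrite t0 t1 seg_id; apply=> [c /null_cycle_DivA/Dspan //|j jn].
  set sg := seg _ _ _; have := clspan sg; rewrite /cl seg0 seg1; apply=> u.
  rewrite seg0; apply: nP.
    by rewrite divr_ge0 //= ler_pdivrMr ?ltr0n // mul1r ler_nat ltnW.
  rewrite addrAC subrr add0r -mulrBl -natrB // subSnn mul1r.
  by rewrite ger0_norm ?mulr_ge0 ?clamp_ge0 // ler_piMr ?clamp_le1.
exists (size r), (fun j => cl (G (tnth (in_tuple r) j))); split=> // z /genspan[k kP].
exists (fun j => k (tnth (in_tuple r) j)).
by rewrite big_tnth in kP.
Qed.

Lemma small_free_finite_rank : redA_free_finite_rank R X.
Proof.
have [n [b [bZ bgen]]] := redA_finitely_generated.
have [m [c [cZ cgen cind]]] := torsion_free_fg_basis (@cycle1_subgroup R X)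
  (@DivA_subgroup R X) (@DivA_cycle R X) (@DivA_purez R X) bZ bgen.
have E k : lincomb k c = \sum_(i < m) c i *~ k i.
  rewrite fct_sumE; apply/funext => s; apply: eq_bigr => i _.
  by rewrite fct_mulrzE -mulrzr intz mulrC.
exists m, c; split=> // [z /cgen[k kP]|k]; last by rewrite E; exact: cind.
by exists k; rewrite csubE E.
Qed.

End FiniteGeneration.

(** * Cardinality of the set of classes *)

Section CardinalityOfClasses.
Variables (R : realType) (X : pseudoMetricType R).
Implicit Types (g h : simplex1 R X) (z : simplex1 R X -> int).

Hypothesis Xh : hausdorff_space X.
Hypothesis Xc : compact [set: X].
Hypothesis Xlpc : locally_path_connected R X.

Lemma hausdorff_ball (x y : X) : x <> y -> exists2 e : R, 0 < e & ~ ball x e y.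
Proof.
move=> xy; have /existsNP[A /existsNP[B]] : ~ cluster (nbhs x) y by move=> /Xh.
move=> /not_implyP[Ax /not_implyP[By AB]].
have /nbhs_ballP[e /= e0 eA] := Ax.
exists e => // /eA Ay; apply: AB; exists y; split=> //; exact: nbhs_singleton.
Qed.

(* A path is encoded by recording, for each rational time, which balls of a
   countable net contain its position. *)
Lemma simplex1_code : exists code : simplex1 R X -> nat -> bool, injective code.
Proof.
have /choice[D DP] (n : nat) : exists D : seq X, forall y, exists2 x, x \in D & ball x n.+1%:R^-1 y.
  have n0 : (0 : R) < n.+1%:R^-1 by rewrite invr_gt0.
  have [D [i [W [iD iW Wx _ Wb]]]] := small_cover Xc Xlpc n0.
  by exists D => y; exists (i y) => //; exact: Wb (Wx _) (iW _).
(* The bit at time [p.1.1], net level [p.1.2] and net index [p.2]. The size guard excludes the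
   default value of [nth], which depends on [g]. *)
pose C g (p : rat * nat * nat) := `[< (p.2 < size (D p.1.2))%N /\
  ball (nth (g 0) (D p.1.2) p.2) p.1.2.+1%:R^-1 (g (ratr p.1.1)) >].
pose code g k := if unpickle k is Some p then C g p else false.
have codeE g p : code g (pickle p) = C g p by rewrite /code pickleK.
exists code.
move=> g h gh; apply/simplex1P; apply: contrapT => /existsNP[t].
move=> /hausdorff_ball[e e0]; apply.
(* Four steps lead from [g t] to [h t]: through [g] at a nearby rational time, a common net point,
   and [h] at that time. *)
have e4 : 0 < e / 4 by rewrite divr_gt0.
have [n nP] : exists n : nat, n.+1%:R^-1 < e / 4.
  by have [n _ /(_ n (leqnn n))] := near_infty_natSinv_lt (PosNum e4); exists n.
have /nbhs_ballP[d /= d0 dP] := @sim1_cont _ _ g t _ (nbhsx_ballx (g t) _ e4).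
have /nbhs_ballP[d' /= d'0 d'P] := @sim1_cont _ _ h t _ (nbhsx_ballx (h t) _ e4).
have [q] : exists q, ratr q \in `]t, (t + Num.min d d')[.
  by apply: rat_in_itvoo; rewrite ltrDl lt_min d0.
rewrite in_itv /= => /andP[tq qt].
have tqd : ball t (Num.min d d') (ratr q).
  by rewrite /ball /= distrC gtr0_norm ?subr_gt0 // ltrBlDl.
have gq : ball (g t) (e / 4) (g (ratr q)).
  by apply: dP; apply: le_ball tqd; rewrite ge_min lexx.
have hq : ball (h t) (e / 4) (h (ratr q)).
  by apply: d'P; apply: le_ball tqd; rewrite ge_min lexx orbT.
have [c cD cg] := DP n (g (ratr q)).
have Cgh p : C g p = C h p by rewrite -!codeE gh.
have : C g (q, n, index c (D n)).
  by apply/asboolP; rewrite /= index_mem nth_index.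
rewrite Cgh => /asboolP /=; rewrite index_mem nth_index // => -[_ ch].
have b4 (u v : X) : ball u n.+1%:R^-1 v -> ball u (e / 4) v by apply: le_ball; exact: ltW.
have -> : e = e / 4 + e / 4 + (e / 4 + e / 4) by field.
have gc := ball_triangle gq (ball_sym (b4 _ _ cg)).
exact: ball_triangle gc (ball_triangle (b4 _ _ ch) (ball_sym hq)).
Qed.

Hypothesis Xpc : path_connected_space R X.

(** Cantor-Bernstein for the set of chosen representative loops: [f] injects binary sequences into
    it, and the codes of paths inject it into binary sequences. *)
Lemma card_continuum_of_injection (x0 : X) (f : (nat -> bool) -> simplex1 R X -> int) :
    (forall u, cycle1 (f u)) -> (forall u v, DivA (f u - f v) -> u = v) ->
  redA_card_continuum R X.
Proof.
move=> fZ finj; have [k0 _] := simplex1_cst (R := R) x0.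
have sD := @DivA_subgroup R X.
pose loops z := [set k : simplex1 R X | cycle1 (single k) /\ DivA (z - single k)].
(* The set [loops z] depends only on the class of [z], so [xget] picks the same loop for equal
   classes. *)
pose rep z := xget k0 (loops z).
have repP z : cycle1 z -> loops z (rep z).
  move=> zz; apply: xgetPex.
  have [k [kx k1 _ kN]] := @cycle_loop _ _ setT x0 z Xpc I zz (fun _ _ _ => I).
  by exists k; split; [apply: cycle1_single; rewrite kx k1|exact: null_cycle_DivA].
have rep_eq z z' : cycle1 z -> cycle1 z' -> rep z = rep z' -> DivA (z - z').
  move=> /repP[_ zr] /repP[_ zr'] E.
  have := sD.2 _ _ zr zr'; rewrite E; congr DivA.
  by rewrite opprB addrA subrK.
have eq_rep z z' : DivA (z - z') -> rep z = rep z'.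
  move=> zz'; rewrite /rep; congr xget; apply/seteqP; split=> k [kZ kz]; split=> //.
    have := sD.2 _ _ kz zz'; congr DivA.
    by apply/funext => s; rewrite !(subfctE, addrfctE, opprfctE); ring.
  have := subgroupD sD kz zz'; congr DivA.
  by apply/funext => s; rewrite !(subfctE, addrfctE, opprfctE); ring.
pose A := rep @` @cycle1 R X.
have : (A #= [set: nat -> bool])%card.
  apply: Cantor_Bernstein.
    have [code codeI] := simplex1_code.
    by apply/pcard_injP; exists code => k k' _ _; exact: codeI.
  suff [i] : $|{injfun [set: nat -> bool] >-> A}| by exact: inj_card_le.
  apply/injfunPex; exists (rep \o f) => [u _|u v _ _ /= E].
    by exists (f u) => //; exact: fZ.
  exact/finj/rep_eq.
move=> /card_set_bijP[h [_ hI hS]].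
(* Inverse of the bijection [h], lifted from representative loops to cycles. *)
have /choice[c cP] : forall u, exists z, cycle1 z /\ h (rep z) = u.
  by move=> u; have [_ [z zz <-] hu] := hS u I; exists z.
have repA z : cycle1 z -> rep z \in A by move=> zz; rewrite inE; exists z.
exists c; split=> [u|u v|z zz]; first by case: (cP u).
  rewrite csubE => /eq_rep E; have [_ <-] := cP u; have [_ <-] := cP v.
  by rewrite E.
exists (h (rep z)); have [cz hc] := cP (h (rep z)).
rewrite csubE; apply: rep_eq => //; apply/esym.
by apply: hI => //; exact: repA.
Qed.

End CardinalityOfClasses.

(** * Infinitely nested loops *)

Section LoopSequences.
Variables (R : realType) (X : pseudoMetricType R) (x0 : X).
Implicit Types (f F : R -> X) (fs : seq (R -> X)) (g : simplex1 R X).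

Definition loopish f := forall t, t <= 0 \/ 1 <= t -> f t = x0.

Fixpoint conc_seq fs : R -> X :=
  if fs is f :: fs' then conc f (conc_seq fs') else fun=> x0.

Lemma conc_seq_le0 fs t : (forall f, List.In f fs -> loopish f) -> t <= 0 ->
  conc_seq fs t = x0.
Proof.
case: fs => [//|f fs] lf t0; rewrite /= concl ?(le_trans t0 ler01) //.
by apply: lf; [left|left].
Qed.

Lemma conc_seq_ge fs t : (forall f, List.In f fs -> loopish f) ->
  (size fs)%:R <= t -> conc_seq fs t = x0.
Proof.
elim: fs t => [//|f fs IH] t lf /= st; have lfs h : List.In h fs -> loopish h.
  by move=> hfs; apply: lf; right.
have [t1|t1] := leP t 1.
  rewrite concl //; apply: lf; first by left.
  by right; apply: le_trans st; rewrite ler1n.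
by rewrite concr // IH // lerBrDr natr1.
Qed.

Lemma conc_seq_osc e fs : 0 < e ->
    (forall f, List.In f fs -> loopish f /\ osc_le e f) -> osc_le e (conc_seq fs).
Proof.
move=> e0; elim: fs => [_ t|f fs IH lf] /=.
  by apply: (@filterE _ (nbhs t)) => s; exact: ballxx.
have lfs h : List.In h fs -> loopish h /\ osc_le e h by move=> hfs; apply: lf; right.
have [ff fe] : loopish f /\ osc_le e f by apply: lf; left.
have c0 t : t <= 0 -> conc_seq fs t = x0.
  by apply: conc_seq_le0 => h /lfs[].
apply: conc_osc => //; first exact: IH.
- by move=> t t1; rewrite !ff //; right.
- by move=> t t0; rewrite !c0.
- by rewrite c0 // ff //; right.
Qed.

Lemma conc_seq_in (A : set X) fs : A x0 ->
  (forall f, List.In f fs -> forall t, A (f t)) -> forall t, A (conc_seq fs t).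
Proof.
move=> Ax; elim: fs => [//|f fs IH] fA t /=; rewrite /conc; case: ifP => _.
  by apply: fA; left.
by apply: IH => h hfs; apply: fA; right.
Qed.

(** Both alternatives are uniform in [F]: the time [t'] depends on [n] and [t] alone, so evaluation
    can be iterated while [F] is still to be constructed. *)
Lemma conc_nseq_eval n t :
  (forall F, conc_seq (nseq n F) t = x0) \/ exists t', forall F, conc_seq (nseq n F) t = F t'.
Proof.
elim: n t => [|n IH] t /=; first by left.
have [t1|t1] := leP t 1; first by right; exists t => F; rewrite concl.
have [H|[t' H]] := IH (t - 1); first by left=> F; rewrite concr.
by right; exists t' => F; rewrite concr.
Qed.

(** The head is the segment over [[0,1]], the tail a shift of the remaining segment; the triangle
    relation peels off one loop at a time. *)
Lemma conc_seq_null (gs : seq (simplex1 R X)) (cc : continuous (conc_seq (map (@sim1 _ _) gs))) :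
  (forall g, List.In g gs -> g 0 = x0 /\ g 1 = x0) ->
  null_cycle (\sum_(g <- gs) single g - single (seg cc 0 (size gs)%:R)).
Proof.
have sN := @null_cycle_subgroup R X.
elim: gs cc => [|g gs IH] cc lg.
  by rewrite big_nil sub0r; apply: (subgroupN sN); exact: seg_refl.
have lgs h : List.In h gs -> h 0 = x0 /\ h 1 = x0 by move=> hgs; apply: lg; right.
have loop (h : simplex1 R X) : h 0 = x0 /\ h 1 = x0 -> loopish h.
  case=> h0 h1 t [] t01; first by rewrite (simplex1_const h).1.
  by rewrite (simplex1_const h).2.
have lloop f : List.In f (map (@sim1 _ _) gs) -> loopish f.
  by move=> /List.in_map_iff[h [<- /lgs]]; exact: loop.
have cc' : continuous (conc_seq (map (@sim1 _ _) gs)).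
  apply/continuous_osc => e e0; apply: conc_seq_osc => // f fgs.
  split; first exact: lloop.
  move/List.in_map_iff : fgs => [h [<- _]].
  by have /continuous_osc := @sim1_cont _ _ h; exact.
have gE : seg cc 0 1 = g.
  apply/simplex1P => t /=; rewrite add0r subr0 mul1r concl ?clamp_le1 //.
  by rewrite [RHS]sim1_canon.
have gsE : seg cc 1 (size gs).+1%:R = seg cc' 0 (size gs)%:R.
  apply/simplex1P => t /=; rewrite -[X in X - 1]natr1 addrK subr0 add0r.
  set a := _ * clamp t; have [a0|a0] := leP a 0.
    rewrite (conc_seq_le0 lloop a0) concl ?gerDl //.
    have a00 : a = 0 by apply/eqP; rewrite eq_le a0 mulr_ge0 ?clamp_ge0.
    by rewrite a00 addr0; case: (lg g); first by left.
  by rewrite concr ?ltrDl // addrC addKr.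
have T := seg_triangle cc 0 1 (size gs).+1%:R.
rewrite gE gsE in T; have := subgroupD sN (IH cc' lgs) T; congr null_cycle.
rewrite big_cons /=; set a := single _; set b := \sum_(_ <- _) _; set c := single _.
set d := single _.
by apply/funext => s; rewrite !(subfctE, addrfctE, opprfctE); ring.
Qed.

End LoopSequences.

Section NestedLoops.
Variables (R : realType) (X : pseudoMetricType R) (x0 : X).
Variables (g : nat -> simplex1 R X) (K : nat -> nat).
Hypothesis g_loop : forall n, g n 0 = x0 /\ g n 1 = x0.
Hypothesis g_small : forall n t, ball x0 n.+1%:R^-1 (g n t).

(* Unfolding [L n = g n * (L n.+1)^(K n + 1)] at a given time either reaches some
   [g m] after finitely many steps, which gives the value of [L n] there, or
   never does, and the value is then [x0]. Continuity holds because [L m] stays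
   in the ball of radius [1/(m+1)] around [x0]. *)
Lemma nested_loops : exists L : nat -> simplex1 R X,
  (forall n, L n 0 = x0 /\ L n 1 = x0) /\
  forall n, null_cycle (single (L n) - (single (g n) + single (L n.+1) *+ (K n).+1)).
Proof.
have gl n : loopish x0 (g n).
  have [g0 g1] := g_loop n; move=> t [] t01; first by rewrite (simplex1_const _).1.
  by rewrite (simplex1_const _).2.
pose word n (F : R -> X) : seq (R -> X) := (g n : R -> X) :: nseq (K n).+1 F.
(* One copy of [g n] and [K n + 1] copies of [F] fill [K n + 2] unit intervals, rescaled to
   [[0,1]]. *)
pose step n F t := conc_seq x0 (word n F) ((K n).+2%:R * t).
have In_word n F f : List.In f (word n F) -> f = g n :> (R -> X) \/ f = F.
  rewrite /word; elim: (K n).+1 => [|k IH] /= [<-|]; try by left.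
  by move=> [<-|H]; [right|apply: IH; right].
have stepE n t : (exists v, forall F, step n F t = v) \/
    exists t', forall F, step n F t = F t'.
  rewrite /step; set s := _ * t; have [s1|s1] := leP s 1.
    by left; exists (g n s) => F; rewrite /word [conc_seq _ _]/= concl.
  have [H|[t' H]] := conc_nseq_eval x0 (K n).+1 (s - 1).
    by left; exists x0 => F; rewrite [conc_seq _ _]/= concr //; exact: H.
  by right; exists t' => F; rewrite [conc_seq _ _]/= concr //; exact: H.
have step_loop n F : loopish x0 F -> loopish x0 (step n F).
  move=> Fl t t01.
  have wl f : List.In f (word n F) -> loopish x0 f by move=> /In_word[] ->.
  case: t01 => t01; first by apply: conc_seq_le0 => //; rewrite pmulr_rle0.
  by apply: conc_seq_ge => //; rewrite /word /= size_nseq ler_peMr.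
(* Unfolding to depth [m] from level [n], with the constant loop in place of what remains. *)
pose fix ev m n {struct m} : R -> X := if m is m'.+1 then step n (ev m' n.+1) else fun=> x0.
have ev_mono m n t : ev m n t <> x0 -> ev m.+1 n t = ev m n t.
  elim: m n t => [//|m IH] n t.
  rewrite -[ev m.+2 n]/(step n (ev m.+1 n.+1)) -[ev m.+1 n]/(step n (ev m n.+1)).
  have [[v H]|[t' H]] := stepE n t; first by rewrite !H.
  by rewrite !H; exact: IH.
have ev_stab n t : exists v, exists N, forall m, (N <= m)%N -> ev m n t = v.
  have [[N Nx]|noN] := pselect (exists N, ev N n t <> x0); last first.
    by exists x0, 0%N => m _; apply: contrapT => mx; apply: noN; exists m.
  exists (ev N n t), N => m; elim: m => [|m IH]; first by rewrite leqn0 => /eqP ->.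
  rewrite leq_eqVlt => /orP[/eqP -> //|Nm].
  by rewrite ev_mono IH.
have /choice[Y YP] (n : nat) : exists Y : R -> X,
    forall t, exists N, forall m, (N <= m)%N -> ev m n t = Y t.
  by have [Y YP] := choice (ev_stab n); exists Y.
have Ystep n t : Y n t = step n (Y n.+1) t.
  have [N NP] := YP n t; have [[v H]|[t' H]] := stepE n t.
    by rewrite -(NP N.+1 (leqnSn N)) [ev _ _]/= !H.
  have [N' N'P] := YP n.+1 t'.
  rewrite -(NP (maxn N N').+1) ?leqW ?leq_maxl // [ev _ _]/= !H.
  by rewrite N'P // leq_maxr.
have ev_loop m n : loopish x0 (ev m n).
  by elim: m n => [//|m IH] n; exact: step_loop.
have Yl n : loopish x0 (Y n).
  by move=> t t01; have [N NP] := YP n t; rewrite -(NP N (leqnn N)) ev_loop.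
have ev_small m n k t : (k <= n)%N -> ball x0 k.+1%:R^-1 (ev m n t).
  have k0 i : (0 : R) < i.+1%:R^-1 by rewrite invr_gt0.
  elim: m n t => [|m IH] n t kn; first exact: ballxx.
  apply: (@conc_seq_in _ _ x0 (ball x0 k.+1%:R^-1)); first exact: ballxx.
  move=> f /In_word[-> s|-> s]; last by apply: IH; exact: leqW.
  by apply: le_ball (g_small n s); rewrite lef_pV2 ?posrE // ler_nat.
have Ysmall n k t : (k <= n)%N -> ball x0 k.+1%:R^-1 (Y n t).
  by move=> kn; have [N NP] := YP n t; rewrite -(NP N (leqnn N)); exact: ev_small.
have step_osc e n F : 0 < e -> loopish x0 F -> osc_le e F -> osc_le e (step n F).
  move=> e0 Fl Fe t.
  have mul_cont : (fun s : R => (K n).+2%:R * s) @ t --> (K n).+2%:R * t.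
    by apply: (@cvgM R); [exact: cvg_cst|exact: cvg_id].
  apply: (mul_cont _ (conc_seq_osc e0 _ _)) => f /In_word[] -> //; split=> //.
  by have /continuous_osc := @sim1_cont _ _ (g n); exact.
have Yc n : continuous (Y n).
  apply/continuous_osc => e e0; have e2 : 0 < e / 2 by rewrite divr_gt0.
  have [N NP] : exists N : nat, N.+1%:R^-1 < e / 2.
    by have [N _ /(_ N (leqnn N))] := near_infty_natSinv_lt (PosNum e2); exists N.
  have : (N <= n + N)%N by rewrite leq_addl.
  (* Induction on the number [j] of levels up to [N]. From level [N] on, the whole loop stays within
     [e / 2] of [x0]; each earlier level adds one [step], which preserves oscillation at scale
     [e]. *)
  move: {2}N => j; elim: j n => [|j IH] n nN.
    move=> t; apply: (@filterE _ (nbhs t)) => s; rewrite addn0 in nN.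
    by apply: (ball_splitr (z := x0)); apply: le_ball (Ysmall _ _ _ nN); exact: ltW.
  rewrite (funext (Ystep n)); apply: step_osc => //.
  by apply: IH; rewrite addSnnS.
have Ycanon n t : Y n t = Y n (clamp t).
  have [t0|t0] := leP t 0; first by rewrite clamp_neg // !Yl //; left.
  have [t1|t1] := leP 1 t; first by rewrite clamp_gt1 // !Yl //; right.
  by rewrite clamp_id // ltW.
pose L n := Simplex1 (Yc n) (Ycanon n).
have LE n : L n 0 = x0 /\ L n 1 = x0 by split; apply: Yl; [left|right].
exists L; split=> // n.
pose gs := g n :: nseq (K n).+1 (L n.+1).
have gsE : map (@sim1 _ _) gs = word n (Y n.+1) by rewrite /gs map_cons map_nseq.
have gsl h : List.In h gs -> h 0 = x0 /\ h 1 = x0.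
  rewrite /gs; elim: (K n).+1 => [|k IH] /= [<-//|].
    by [].
  by move=> [<-|H]; [exact: LE|apply: IH; right].
have cc : continuous (conc_seq x0 (map (@sim1 _ _) gs)).
  rewrite gsE; apply/continuous_osc => e e0; apply: conc_seq_osc => // f.
  by move=> /In_word[] ->; split=> //;
    [have /continuous_osc := @sim1_cont _ _ (g n)|have /continuous_osc := Yc n.+1]; exact.
have LsE : L n = seg cc 0 (size gs)%:R.
  apply/simplex1P => t; rewrite [LHS]sim1_canon [L n _]Ystep /step -gsE.
  by rewrite /seg [RHS]/= add0r subr0 size_nseq.
have := subgroupN (@null_cycle_subgroup R X) (conc_seq_null cc gsl).
rewrite -LsE opprB; congr (null_cycle (_ - _)).
by rewrite big_cons big_nseq iter_addr addr0.
Qed.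

End NestedLoops.

(** * An injection of binary sequences into the reduced quotient *)

Section NestedClasses.
Variables (R : realType) (X : pseudoMetricType R) (x0 : X).

Hypothesis essential_loops : forall U : set X, nbhs x0 U ->
  exists k : simplex1 R X, [/\ k 0 = x0, k 1 = x0, forall t, U (k t) & ~ DivA (single k)].

Lemma continuum_many_classes : exists f : (nat -> bool) -> simplex1 R X -> int,
  (forall u, cycle1 (f u)) /\ forall u v, DivA (f u - f v) -> u = v.
Proof.
have sD := @DivA_subgroup R X; have sZ := @cycle1_subgroup R X.
have /choice[g gP] (n : nat) : exists k : simplex1 R X,
    [/\ k 0 = x0, k 1 = x0, forall t, ball x0 n.+1%:R^-1 (k t) & ~ DivA (single k)].
  by apply: essential_loops; apply: nbhsx_ballx; rewrite invr_gt0.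
have /choice[K KP] (n : nat) : exists k : nat, forall c, cycle1 c ->
    ~ DivA (single (g n) - c *+ k.+1).
  have [g0 g1 _ gD] := gP n; apply: redA_reduced => //.
  by apply: cycle1_single; rewrite g0 g1.
(* The constant loop replaces [g n] where [u n] is false, so the exponents are the same for all
   [u]. *)
have [e [ex eN]] := simplex1_cst (R := R) x0.
have /choice[L LP] (u : nat -> bool) : exists L : nat -> simplex1 R X,
    (forall n, L n 0 = x0 /\ L n 1 = x0) /\ forall n, null_cycle
      (single (L n) - (single (if u n then g n else e) + single (L n.+1) *+ (K n).+1)).
  apply: nested_loops => [n|n t]; case: (u n); rewrite ?ex //.
  - by case: (gP n).
  - by case: (gP n).
  - by apply: ballxx; rewrite invr_gt0.
have LZ u n : cycle1 (single (L u n)).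
  by have [/(_ n) [L0 L1] _] := LP u; apply: cycle1_single; rewrite L0 L1.
(* If the letters differed, [single (g n)] would be a [(K n + 1)]-fold multiple modulo [DivA],
   against the choice of [K]. *)
have first_letter u v n : DivA (single (L u n) - single (L v n)) -> u n -> v n.
  move=> Duv un; apply: contrapT => /negP/negPf vn.
  have Nu := null_cycle_DivA ((LP u).2 n); have Nv := null_cycle_DivA ((LP v).2 n).
  rewrite un in Nu; rewrite vn in Nv.
  apply: (KP n (single (L v n.+1) - single (L u n.+1))); first exact: sZ.2.
  have := subgroupD sD (sD.2 _ _ (subgroupD sD Duv Nv) Nu) (null_cycle_DivA eN).
  congr DivA; rewrite mulrnBl; apply/funext => s.
  by rewrite !(subfctE, addrfctE, opprfctE); ring.
(* Equal letters cancel, leaving a [(K n + 1)]-fold multiple in [DivA], from which purity removes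
   the factor. *)
have next u v n : u n = v n -> DivA (single (L u n) - single (L v n)) ->
    DivA (single (L u n.+1) - single (L v n.+1)).
  move=> uv Duv; apply: (@DivA_pure _ _ _ (K n)); first exact: sZ.2.
  have Nu := null_cycle_DivA ((LP u).2 n); have Nv := null_cycle_DivA ((LP v).2 n).
  rewrite uv in Nu.
  have := sD.2 _ _ (subgroupD sD Duv Nv) Nu.
  congr DivA; rewrite mulrnBl; apply/funext => s.
  by rewrite !(subfctE, addrfctE, opprfctE); ring.
exists (fun u => single (L u 0%N)); split=> // u v Duv.
have eqn n : DivA (single (L u n) - single (L v n)) -> u n = v n.
  move=> D; apply/idP/idP; first exact: first_letter.
  by apply: first_letter; rewrite -opprB; exact: subgroupN.
have D n : DivA (single (L u n) - single (L v n)).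
  by elim: n => [//|n IH]; apply: next => //; exact: eqn.
by apply/funext => n; exact: eqn.
Qed.

End NestedClasses.

(** Metrizability is expressed by a pseudometric structure together with the Hausdorff property. *)
Theorem theorem3p5 (R : realType) (X : pseudoMetricType R) :
  hausdorff_space X ->
  compact [set: X] ->
  path_connected_space R X ->
  locally_path_connected R X ->
  redA_free_finite_rank R X \/ redA_card_continuum R X.
Proof.
move=> Xh Xc Xpc Xlpc.
have [small|] := pselect (forall x : X, exists U : set X, nbhs x U /\
  forall k : simplex1 R X, k 0 = x -> k 1 = x -> (forall t, U (k t)) -> DivA (single k)).
  by left; exact: small_free_finite_rank.
move=> /existsNP[x /forallNP xU]; right.
have [U Ux|f [fZ finj]] := @continuum_many_classes R X x.
  have /not_andP[//|/existsNP[k /not_implyP[k0 /not_implyP[k1 /not_implyP[kU kD]]]]] := xU U.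
  by exists k.
exact: card_continuum_of_injection fZ finj.
Qed.
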